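(* Let $d\ge 1$, let $q$ be an integer with $d\le q\le 2d-1$, and let $\mu=(\mu_0,\ldots,\mu_q)\in\mathbb{R}^{q+1}$ be arbitrary. Then the root mapping $RM_d:H_d\to\mathcal{P}^X_d$ transforms isomorphically the set $L^h_q(\mu)$ into (i.e. onto) the projected Prony leaf $S^X_q(\mu)$, while its inverse, the Vieta mapping $\mathcal{V}_d$, transforms $S^X_q(\mu)$ back into (i.e. onto) $L^h_q(\mu)$. Thus the mapping $$RM_d:L^h_q(\mu)\to S^X_q(\mu)$$ provides an isomorphic parametrization of $S^X_q(\mu)$. In other words, $S^X_q(\mu)\subset\mathcal{P}^X_d$ is parametrized by the hyperbolic polynomials $Q\in L^h_q(\mu)$, $Q(z)=z^d+\sigma_1z^{d-1}+\cdots+\sigma_d$, via associating to $Q$ its ordered roots $X=(x_1,\ldots,x_d)\in\mathcal{P}^X_d$.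
   Context: Parameter space: $\mathcal{P}^A_d=\mathbb{R}^d$ is the space of amplitudes $A=(a_1,\ldots,a_d)$; $\mathcal{P}^X_d=\{X=(x_1,\ldots,x_d)\in\mathbb{R}^d : x_1<x_2<\cdots<x_d\}$ is the space of nodes (nodes are always assumed pairwise different and ordered); $\mathcal{P}_d=\mathcal{P}^A_d\times\mathcal{P}^X_d$. Prony leaf: $S_q(\mu)=\{(A,X)\in\mathcal{P}_d : \sum_{j=1}^d a_jx_j^k=\mu_k,\ k=0,1,\ldots,q\}$. Its projection to the nodes space, i.e. its image under $(A,X)\mapsto X$, is denoted $S^X_q(\mu)\subset\mathcal{P}^X_d$. $V_d\cong\mathbb{R}^d$ is the space of coefficient vectors $\sigma=(\sigma_1,\ldots,\sigma_d)$, identified with the monic polynomials $Q(z)=z^d+\sigma_1z^{d-1}+\cdots+\sigma_d$. Put $\sigma_0=1$. The affine subspace $L_q(\mu)\subset V_d$ (possibly empty, or of any dimension not smaller than $2d-q-1$) is the set of all $\sigma\in V_d$ with $\sum_{i=0}^d\mu_{l-i}\sigma_i=0$ for $l=d,d+1,\ldots,q$. $H_d\subset V_d$ is the set of hyperbolic polynomials: those $Q$ whose $d$ roots are all real and pairwise different. $L^h_q(\mu)=L_q(\mu)\cap H_d$. The root mapping $RM_d:H_d\to\mathcal{P}^X_d$ sends $Q$ to the vector $(x_1,\ldots,x_d)$ of its ordered roots $x_1<\cdots<x_d$. The Vieta mapping $\mathcal{V}_d:\mathcal{P}^X_d\to H_d$ sends $X$ to $(\sigma_1(X),\ldots,\sigma_d(X))$,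 where $\sigma_i(X)=(-1)^i\sum_{1\le j_1<\cdots<j_i\le d}x_{j_1}\cdots x_{j_i}$, i.e. to the coefficient vector of $\prod_{j=1}^d(z-x_j)$. One has $RM_d=\mathcal{V}_d^{-1}$. ''Isomorphic'' is meant in the sense of regular (real-analytic) maps: $RM_d$ and $\mathcal{V}_d$ are mutually inverse real-analytic maps between the open sets $H_d\subset V_d$ and $\mathcal{P}^X_d\subset\mathbb{R}^d$, and the isomorphism between $L^h_q(\mu)$ and $S^X_q(\mu)$ is the bijection obtained by restricting them. *)

(* Defs.v *)
From HB Require Import structures.
From mathcomp Require Import all_boot all_order all_algebra.
From mathcomp Require Import all_classical all_reals all_analysis.

Set Implicit Arguments.
Unset Strict Implicit.
Unset Printing Implicit Defensive.

Import Order.TTheory GRing.Theory Num.Theory.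
Import numFieldNormedType.Exports.

Local Open Scope classical_set_scope.
Local Open Scope ring_scope.

Section RealAnalytic.
Variables (R : realType) (n : nat).

(* The term c_alpha * h^alpha, alpha = (alpha_1, ..., alpha_n) a multi-index. *)
Definition pseries_term (c : {ffun 'I_n -> nat} -> R) (h : 'rV[R]_n)
    (alpha : {ffun 'I_n -> nat}) : R :=
  c alpha * \prod_(i < n) h 0 i ^+ alpha i.

(* The power series converges absolutely at h, with sum l.  The order of
   summation is then immaterial; partial sums are taken over the multi-indices
   all of whose components are < N. *)
Definition pseries_sum (c : {ffun 'I_n -> nat} -> R) (h : 'rV[R]_n) (l : R) :=
  summable [set: {ffun 'I_n -> nat}] (EFin \o pseries_term c h) /\
  (fun N : nat => \sum_(alpha : {ffun 'I_n -> 'I_N})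
     pseries_term c h [ffun i => nat_of_ord (alpha i)]) @ \oo --> l.

Definition real_analytic_at (f : 'rV[R]_n -> R) (a : 'rV[R]_n) :=
  exists c : {ffun 'I_n -> nat} -> R,
    \forall x \near a, pseries_sum c (x - a) (f x).

Definition real_analytic_on m (U : set 'rV[R]_n) (F : 'rV[R]_n -> 'rV[R]_m) :=
  forall j : 'I_m, forall a, U a -> real_analytic_at (fun x => F x 0 j) a.

End RealAnalytic.

(* F : U -> V and G : V -> U are mutually inverse real-analytic maps between
   open subsets of R^n; only the values of F on U and of G on V matter. *)
Definition analytic_iso (R : realType) n (U V : set 'rV[R]_n)
    (F G : 'rV[R]_n -> 'rV[R]_n) : Prop :=
  [/\ open U /\ open V,
      set_fun U V F /\ set_fun V U G,
      {in U, cancel F G} /\ {in V, cancel G F},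
      real_analytic_on U F & real_analytic_on V G].

Section Prony.
Variables (R : realType) (d : nat).
Implicit Types (A X sigma : 'rV[R]_d).

Definition PX : set 'rV[R]_d :=
  [set X | forall i j : 'I_d, (i < j)%N -> X 0 i < X 0 j].

(* P_d = R^d x PX; the first component is the amplitude vector. *)
Definition Pd : set ('rV[R]_d * 'rV[R]_d) := [set AX | PX AX.2].

Definition prony_leaf q (mu : 'rV[R]_q.+1) : set ('rV[R]_d * 'rV[R]_d) :=
  [set AX | Pd AX /\
    forall k : 'I_q.+1, \sum_(j < d) AX.1 0 j * AX.2 0 j ^+ k = mu 0 k].

Definition prony_leafX q (mu : 'rV[R]_q.+1) : set 'rV[R]_d :=
  snd @` prony_leaf mu.

(* sigma_0 = 1, and sigma_i is the entry of index i - 1 of the row vector sigma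
   for 1 <= i <= d. *)
Definition sig sigma (i : 'I_d.+1) : R := oapp (sigma 0) 1 (unlift ord0 i).

(* z^d + sigma_1 z^(d-1) + ... + sigma_d *)
Definition poly_of sigma : {poly R} :=
  \sum_(i < d.+1) sig sigma i *: 'X^(d - i).

(* Since i <= d <= l <= q, [l - i] is not truncated and inord (l - i) is the
   index l - i in {0, ..., q}. *)
Definition Lq q (mu : 'rV[R]_q.+1) : set 'rV[R]_d :=
  [set sigma | forall l : 'I_q.+1, (d <= l)%N ->
    \sum_(i < d.+1) mu 0 (inord (l - i)) * sig sigma i = 0].

(* s is the sequence of the roots, with multiplicities. *)
Definition Hd : set 'rV[R]_d :=
  [set sigma | exists s : seq R,
    poly_of sigma = \prod_(x <- s) ('X - x%:P) /\ uniq s].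

Definition Lhq q (mu : 'rV[R]_q.+1) : set 'rV[R]_d := Lq mu `&` Hd.

Definition ordered_roots sigma X : Prop :=
  PX X /\ forall x : R, root (poly_of sigma) x <-> exists j, x = X 0 j.

(* The ordered roots of sigma when sigma \in Hd (they exist and are unique);
   a default value otherwise. *)
Definition RM sigma : 'rV[R]_d := xget 0 [set X | ordered_roots sigma X].

Definition vieta X : 'rV[R]_d :=
  \row_(i < d) ((-1) ^+ i.+1 *
    \sum_(J : {set 'I_d} | #|J| == i.+1) \prod_(j in J) X 0 j).

End Prony.

Arguments PX : clear implicits.
Arguments Hd : clear implicits.
Arguments prony_leafX {R} d {q} mu.
Arguments Lhq {R} d {q} mu.

(* Main.v *)
(* Vieta's formulas identify X with the coefficients of the monic polynomial Q
   whose simple roots are the x_j, so only two facts need work.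
   Prony: if Q vanishes at all nodes, the moments m_k of any amplitudes at X
   satisfy the linear recurrence with coefficients sigma; conversely a Vandermonde
   system finds amplitudes with the first d prescribed moments, and the
   recurrence then forces m_k = mu_k up to k = q.
   Analyticity of the roots: near a simple root x0 of the polynomial of sigma0,
   the increment y is the solution of a polynomial equation y = g(h, y), with
   h = sigma - sigma0, whose terms of degree at most 1 in y vanish at h = 0.  The
   iterates u_{k+1} = g(h, u_k) are polynomials in h; by Cauchy's majorant method
   (replace all coefficients by their absolute values) both their values and their
   coefficients converge, and the limit coefficients form the power series of y. *)

Require Import Defs.
From mathcomp Require Import all_boot all_order all_algebra.
From mathcomp Require Import all_classical all_reals all_analysis.
From mathcomp Require Import ring lra zify.
From mathcomp Require Import -(notations) mpoly.

Set Implicit Arguments.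
Unset Strict Implicit.
Unset Printing Implicit Defensive.

Import Order.TTheory GRing.Theory Num.Theory.
Import numFieldNormedType.Exports.

Local Open Scope classical_set_scope.
Local Open Scope ring_scope.

Local Notation "p @_ m" := (mcoeff m p) (at level 3, m at level 2).

(** * Power series with dominated coefficients *)

(** Monotone convergence replaces the Cauchy criterion: [X] and [X \- x] are both nondecreasing and
    bounded, and [x] is their difference. *)
Lemma dominated_increments_cvg (R : realType) (x X : R^nat) (B : R) :
    (forall k, `|x k.+1 - x k| <= X k.+1 - X k) -> (forall k, X k <= B) ->
  exists lx lX : R, [/\ x @ \oo --> lx, X @ \oo --> lX &
                      forall k, `|lx - x k| <= lX - X k].
Proof.
move=> dx XB.
have incr (y : R^nat) : (forall k, y k <= y k.+1) ->
    {homo y : m n / (m <= n)%N >-> m <= n}.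
  move=> yS m n; elim: n => [|n IHn]; first by rewrite leqn0 => /eqP ->.
  by rewrite leq_eqVlt => /orP[/eqP ->//|/IHn] /le_trans; apply.
have Xi : {homo X : m n / (m <= n)%N >-> m <= n}.
  by apply: incr => k; rewrite -subr_ge0; exact: le_trans (normr_ge0 _) (dx k).
have Xc : cvgn X.
  apply: (nondecreasing_is_cvgn Xi); exists B => _ [k _ <-]; exact: XB.
have dxm m n : (m <= n)%N -> `|x n - x m| <= X n - X m.
  elim: n => [|n IHn]; first by rewrite leqn0 => /eqP ->; rewrite !subrr normr0.
  rewrite leq_eqVlt => /orP[/eqP ->|/IHn mn]; first by rewrite !subrr normr0.
  apply: le_trans (ler_distD (x n) _ _) _.
  by rewrite (_ : X _ - X _ = X n.+1 - X n + (X n - X m)) ?lerD// addrA subrK.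
have Zc : cvgn (X \- x).
  apply: nondecreasing_is_cvgn.
    apply: incr => k /=; have := le_trans (ler_norm _) (dx k).
    lra.
  (* From [|x k - x 0| <= X k - X 0 <= B - X 0] and [X k <= B]. *)
  exists (B + (B - X 0%N) - x 0%N) => _ [k _ <-] /=.
  have /ler_normlP[+ _] := dxm _ _ (leq0n k).
  have := XB k; lra.
have xc : cvgn x.
  have -> : x = X \- (X \- x) by apply/funext => k /=; rewrite opprB addrCA subrr addr0.
  exact: is_cvgB.
exists (limn x), (limn X); split => // k.
have cl : (fun n => `|x n - x k|) @ \oo --> `|limn x - x k|.
  by apply: cvg_norm; apply: cvgB => //; exact: cvg_cst.
have cr : (fun n => X n - X k) @ \oo --> limn X - X k.
  by apply: cvgB => //; exact: cvg_cst.
rewrite -(cvg_lim _ cl)// -(cvg_lim _ cr)//.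
apply: ler_lim.
- by apply/cvg_ex; eexists; exact: cl.
- by apply/cvg_ex; eexists; exact: cr.
- by near=> n; apply: dxm; near: n; exact: nbhs_infty_ge.
Unshelve. all: by end_near. Qed.

(** * Monomials, boxes of exponents and majorized evaluation *)

Section MPoly.
Variables (R : realType) (n : nat).
Implicit Types (p q P Q u v U V : mpoly n R) (m : multinom n) (h : 'I_n -> R).

Definition mnm_of (alpha : 'I_n -> nat) : multinom n :=
  Multinom [tuple alpha i | i < n].

(** These are the monomials over which the partial sums of [pseries_sum] run. *)
Definition box_mnm N (alpha : {ffun 'I_n -> 'I_N}) : multinom n :=
  mnm_of (fun i => alpha i : nat).

Lemma mnm_of_inj (a b : 'I_n -> nat) : mnm_of a = mnm_of b -> a =1 b.
Proof. by move=> /mnmP ab i; have := ab i; rewrite !mnmE. Qed.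

Lemma box_mnm_inj N : injective (@box_mnm N).
Proof. by move=> a b /mnm_of_inj ab; apply/ffunP => i; apply/val_inj/ab. Qed.

Definition mmonomial h m : R := \prod_(i < n) h i ^+ m i.

Lemma mmonomial_le h (r : R) m : (forall i, `|h i| <= r) ->
  `|mmonomial h m| <= mmonomial (fun=> r) m.
Proof.
move=> hr; rewrite normr_prod; apply: ler_prod => i _.
by rewrite normr_ge0 normrX lerXn2r// nnegrE (le_trans _ (hr i)).
Qed.

Lemma mmonomial_ge0 (r : R) m : 0 <= r -> 0 <= mmonomial (fun=> r) m.
Proof. by move=> r0; apply: prodr_ge0 => i _; exact: exprn_ge0. Qed.

Lemma sum_mcoeff_le P (r : R) (s : seq (multinom n)) :
    (forall m, 0 <= P@_m) -> 0 <= r -> uniq s ->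
  \sum_(m <- s) P@_m * mmonomial (fun=> r) m <= meval (fun=> r) P.
Proof.
move=> P0 r0 us; rewrite mevalE.
rewrite (bigID (mem (msupp P)))/= [X in _ + X]big1 ?addr0; last first.
  by move=> m /memN_msupp_eq0 ->; rewrite mul0r.
rewrite [leRHS](bigID (mem s))/= -big_filter -[X in _ <= X + _]big_filter.
rewrite [X in X + _](perm_big [seq m <- s | m \in msupp P]); last first.
  apply: uniq_perm; rewrite ?filter_uniq ?msupp_uniq// => m.
  by rewrite !mem_filter andbC.
by rewrite lerDl sumr_ge0// => m _; rewrite mulr_ge0// mmonomial_ge0.
Qed.

(** Every monomial of [p] has its degree, hence each exponent, below [mmeasure mdeg p], so the box
    contains the whole support. *)
Lemma box_sum_msize p h N : (mmeasure mdeg p <= N)%N ->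
  \sum_(alpha : {ffun 'I_n -> 'I_N}) p@_(box_mnm alpha) * mmonomial h (box_mnm alpha) =
  meval h p.
Proof.
move=> pN; rewrite mevalE.
rewrite -big_enum -(big_map (@box_mnm N) xpredT (fun m => p@_m * mmonomial h m)).
rewrite (bigID (mem (msupp p)))/= [X in _ + X]big1 ?addr0; last first.
  by move=> m /memN_msupp_eq0 ->; rewrite mul0r.
rewrite -big_filter; apply: perm_big; apply: uniq_perm.
- by rewrite filter_uniq// map_inj_uniq ?enum_uniq//; exact: box_mnm_inj.
- exact: msupp_uniq.
move=> m; rewrite mem_filter andb_idr// => mp.
have mN i : (m i < N)%N.
  apply: leq_trans pN; apply: leq_ltn_trans (msize_mdeg_lt mp).
  by rewrite mdegE (bigD1 i)//= leq_addr.
apply/mapP; exists [ffun i => Ordinal (mN i)]; first by rewrite mem_enum.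
by apply/mnmP => i; rewrite mnmE ffunE.
Qed.

End MPoly.

Lemma meval_majorized (R : realType) n (p P : mpoly n R) (h : 'I_n -> R) (r : R) :
    (forall m, `|p@_m| <= P@_m) -> (forall i, `|h i| <= r) ->
  `|meval h p| <= meval (fun=> r) P.
Proof.
move=> pP hr.
(* Both evaluations become sums over one common box and are compared term by term. *)
rewrite -(@box_sum_msize _ _ p h _ (leq_maxl _ (mmeasure mdeg P))).
rewrite -(@box_sum_msize _ _ P _ _ (leq_maxr (mmeasure mdeg p) _)).
apply: le_trans (ler_norm_sum _ _ _) _; apply: ler_sum => alpha _.
by rewrite normrM ler_pM// mmonomial_le.
Qed.

(* The increments of [u] are dominated coefficientwise by those of [U], so the
   tails of all series involved are bounded by those of the bounded monotone
   sequence [meval (fun=> r) (U k)]. *)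
Lemma pseries_of_dominated (R : realType) n (u U : nat -> mpoly n R) (r B : R) :
    0 < r -> (forall k m, `|(u k)@_m| <= (U k)@_m) ->
    (forall k m, `|(u k.+1)@_m - (u k)@_m| <= (U k.+1)@_m - (U k)@_m) ->
    (forall k, meval (fun=> r) (U k) <= B) ->
  exists c, forall h : 'rV[R]_n, (forall i, `|h 0 i| <= r) ->
    exists l, [/\ meval (h 0) (u k) @[k --> \oo] --> l, `|l| <= B &
                  pseries_sum c h l].
Proof.
move=> r0 uU du UB.
have U0 k m : 0 <= (U k)@_m by apply: le_trans (uU k m).
have dU k m : 0 <= (U k.+1)@_m - (U k)@_m by apply: le_trans (du k m).
have Ui k K m : (k <= K)%N -> (U k)@_m <= (U K)@_m.
  elim: K => [|K IHK]; first by rewrite leqn0 => /eqP ->.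
  rewrite leq_eqVlt => /orP[/eqP ->//|/IHK] /le_trans; apply.
  by rewrite -subr_ge0.
have rm m : 0 < mmonomial (fun=> r) m by apply: prodr_gt0 => i _; exact: exprn_gt0.
have UBm m k : (U k)@_m <= B / mmonomial (fun=> r) m.
  rewrite ler_pdivlMr//; apply: le_trans (UB k).
  have := @sum_mcoeff_le R n (U k) r [:: m] (U0 k) (ltW r0) isT.
  by rewrite big_seq1.
(* [c'] and [C'] are the coefficientwise limits of [u] and [U]. *)
have [c' c'P] := choice (fun m => dominated_increments_cvg (du^~ m) (UBm m)).
have [C' C'P] := choice c'P.
have dUr k : `|meval (fun=> r) (U k.+1) - meval (fun=> r) (U k)| <=
    meval (fun=> r) (U k.+1) - meval (fun=> r) (U k).
  rewrite -mevalB; apply: meval_majorized; last by move=> i; rewrite ger0_norm// ltW.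
  by move=> m; rewrite mcoeffB ger0_norm.
have [L0 [L [_ UL LU]]] := dominated_increments_cvg dUr UB.
have LB : L <= B.
  rewrite -(cvg_lim _ UL)//; apply: limr_le; first by apply/cvg_ex; exists L.
  by near=> k; exact: UB.
(* The bound is uniform in the finite family [s]: it holds for [U K - U k] by nonnegativity of the
   coefficients, and then [K] tends to infinity. *)
have tail k (s : seq (multinom n)) : uniq s ->
    \sum_(m <- s) (C' m - (U k)@_m) * mmonomial (fun=> r) m <=
    L - meval (fun=> r) (U k).
  move=> us.
  have cs : \sum_(m <- s) ((U K)@_m - (U k)@_m) * mmonomial (fun=> r) m @[K --> \oo]
      --> \sum_(m <- s) (C' m - (U k)@_m) * mmonomial (fun=> r) m.
    apply: cvg_big; first exact: add_continuous.
    move=> m _; apply: cvgMr_tmp; apply: cvgB; last exact: cvg_cst.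
    by have [] := C'P m.
  rewrite -(cvg_lim _ cs)//; apply: limr_le; first by apply/cvg_ex; eexists; exact: cs.
  near=> K.
  have kK : (k <= K)%N by near: K; exact: nbhs_infty_ge.
  apply: le_trans (_ : meval (fun=> r) (U K - U k) <= _).
    under eq_bigr do rewrite -mcoeffB.
    apply: sum_mcoeff_le => //; last exact: ltW.
    by move=> m; rewrite mcoeffB subr_ge0 Ui.
  by rewrite mevalB lerD2r -subr_ge0 (le_trans (normr_ge0 _) (LU K)).
exists (fun alpha => c' (mnm_of alpha)) => h hr.
have duh k : `|meval (h 0) (u k.+1) - meval (h 0) (u k)| <=
    meval (fun=> r) (U k.+1) - meval (fun=> r) (U k).
  by rewrite -!mevalB; apply: meval_majorized => // m; rewrite !mcoeffB.
have [l [_ [ul /(cvg_unique _ UL) <-// lu]]] := dominated_increments_cvg duh UB.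
exists l; split=> //.
  have cl : `|meval (h 0) (u k)| @[k --> \oo] --> `|l| by exact: cvg_norm.
  rewrite -(cvg_lim _ cl)//; apply: limr_le; first by apply/cvg_ex; eexists; exact: cl.
  near=> k; apply: le_trans (UB k); exact: meval_majorized.
have C'c m : `|c' m| <= C' m.
  have [_ _ /(_ 0%N)] := C'P m; have := uU 0%N m; rewrite !ler_norml.
  by move=> /andP[? ?] /andP[? ?]; apply/andP; split; lra.
split.
  rewrite /summable.
  (* The tail bound at [k = 0] plus the value of [U 0] bounds every finite sum of absolute
     values. *)
  apply: le_lt_trans (ltry (L - meval (fun=> r) (U 0%N) + meval (fun=> r) (U 0%N))).
  apply: ge_ereal_sup => _ [A [fA _] <-].
  rewrite fsbig_finite//= sumEFin lee_fin.
  pose s := [seq mnm_of (alpha : {ffun 'I_n -> nat})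
            | alpha <- finmap.enum_fset (fset_set A)].
  have us : uniq s.
    rewrite map_inj_uniq ?finmap.fset_uniq// => a b /mnm_of_inj ab.
    by apply/ffunP => i; exact: ab.
  apply: le_trans (lerD (tail 0%N s us) (sum_mcoeff_le (U0 0%N) (ltW r0) us)).
  rewrite -big_split/= big_map; apply: ler_sum => alpha _.
  rewrite -mulrDl subrK normrM ler_pM//.
  have -> : \prod_(i < n) h 0 i ^+ alpha i = mmonomial (h 0) (mnm_of alpha).
    by apply: eq_bigr => i _; rewrite mnmE.
  exact: mmonomial_le.
apply/cvgrPdist_le => e e0.
(* First [k] is fixed, then [N] is taken so large that the box sums [u k] exactly. Both [l] and the
   box sum of the limit coefficients differ from [meval (h 0) (u k)] by at most
   [L - meval (fun=> r) (U k)]. *)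
have [k Lk] : exists k, L - meval (fun=> r) (U k) <= e / 2.
  have /cvgrPdist_le/(_ (e / 2)) := UL; rewrite divr_gt0// => /(_ isT)[k _ /(_ k)]/= kP.
  by exists k; apply: le_trans (ler_norm _) (kP _).
near=> N.
have uN : (mmeasure mdeg (u k) <= N)%N by near: N; exact: nbhs_infty_ge.
have -> : \sum_(alpha : {ffun 'I_n -> 'I_N}) pseries_term
      (fun a => c' (mnm_of a)) h [ffun i => nat_of_ord (alpha i)] =
    \sum_(alpha : {ffun 'I_n -> 'I_N})
      c' (box_mnm alpha) * mmonomial (h 0) (box_mnm alpha).
  apply: eq_bigr => alpha _; rewrite /pseries_term; congr (c' _ * _).
    by apply/mnmP => i; rewrite !mnmE ffunE.
  by apply: eq_bigr => i _; rewrite mnmE ffunE.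
rewrite (splitr e); apply: le_trans (ler_distD (meval (h 0) (u k)) _ _) _.
apply: lerD; first exact: le_trans (lu k) Lk.
rewrite -(box_sum_msize _ uN) -sumrB; apply: le_trans Lk.
have ub : uniq (map (@box_mnm n N) (enum {: {ffun 'I_n -> 'I_N}})).
  by rewrite map_inj_uniq ?enum_uniq//; exact: box_mnm_inj.
apply: le_trans (tail k _ ub); rewrite big_map big_enum/=.
apply: le_trans (ler_norm_sum _ _ _) _; apply: ler_sum => alpha _.
rewrite -mulrBl normrM distrC ler_pM// ?mmonomial_le//.
by have [_ _] := C'P (box_mnm alpha).
Unshelve. all: by end_near. Qed.

(** * Majorants and analytic fixed points *)

Section Majorant.
Variables (R : realType) (n : nat).
Implicit Types (p u v U V : mpoly n R) (m : multinom n) (g : {poly mpoly n R}).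

Definition mabs p : mpoly n R := \sum_(m <- msupp p) `|p@_m| *: mpolyX R m.

Lemma mcoeff_mabs p m : (mabs p)@_m = `|p@_m|.
Proof.
rewrite raddf_sum/=; under eq_bigr do rewrite mcoeffZ mcoeffX.
have [mp|mp] := boolP (m \in msupp p).
  rewrite (bigD1_seq m)//= eqxx mulr1 big1 ?addr0// => k /negPf ->.
  by rewrite mulr0.
rewrite (memN_msupp_eq0 mp) normr0 big_seq big1// => k kp.
by case: eqP => [km|]; [rewrite km (negPf mp) in kp|rewrite mulr0].
Qed.

(** For [r <= 1] every nonconstant monomial is at most [r]; if the constant term vanishes, the
    majorant therefore becomes small with [r]. *)
Lemma meval_mabs_le p (r : R) : 0 <= r <= 1 ->
  meval (fun=> r) (mabs p) <= `|p@_mnm0| + r * meval (fun=> 1) (mabs p).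
Proof.
move=> /andP[r0 r1]; rewrite -mcoeff_mabs !raddf_sum/= mulr_sumr -big_split/=.
apply: ler_sum => m _; rewrite !mevalZ !mevalX mcoeffZ mcoeffX mulrCA -mulrDr.
apply: ler_wpM2l => //; rewrite [X in r * X]big1 ?mulr1; last first.
  by move=> i _; rewrite expr1n.
case: eqP => [->|/eqP m0]; first by rewrite big1 ?lerDl// => i _; rewrite mnm0E.
rewrite add0r prodrXr -[leRHS]expr1 -mdegE.
by apply: ler_wiXn2l => //; rewrite lt0n mdeg_eq0.
Qed.

(* To be read as: [v] and the increment [u - v] are majorized, coefficient by
   coefficient, by [V] and [U - V].  Unlike majorization of [u - v] alone, this
   is stable under products. *)
Definition dominated v u V U : Prop :=
  forall m, `|v@_m| <= V@_m /\ `|u@_m - v@_m| <= U@_m - V@_m.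

Lemma dominated_mabs p : dominated p p (mabs p) (mabs p).
Proof. by move=> m; rewrite mcoeff_mabs !subrr normr0. Qed.

Lemma dominatedD v u V U v' u' V' U' :
  dominated v u V U -> dominated v' u' V' U' ->
  dominated (v + v') (u + u') (V + V') (U + U').
Proof.
move=> d d' m; rewrite !mcoeffD; case: (d m) (d' m) => [a b] [a' b'].
split; first by rewrite (le_trans (ler_normD _ _))// lerD.
by rewrite !opprD !(addrACA _ _ (- _)) (le_trans (ler_normD _ _))// lerD.
Qed.

Lemma dominatedM v u V U v' u' V' U' :
  dominated v u V U -> dominated v' u' V' U' ->
  dominated (v * v') (u * u') (V * V') (U * U').
Proof.
move=> d d' m; rewrite !mcoeffM; split.
  apply: le_trans (ler_norm_sum _ _ _) _; apply: ler_sum => k _.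
  by rewrite normrM ler_pM//; [case: (d k.1)|case: (d' k.2)].
rewrite -!sumrB; apply: le_trans (ler_norm_sum _ _ _) _; apply: ler_sum => k _.
case: (d k.1) (d' k.2) => [a b] [a' b'].
set x := u@__; set y := v@__; set x' := u'@__; set y' := v'@__.
set X := U@__; set Y := V@__; set X' := U'@__; set Y' := V'@__.
have -> : x * x' - y * y' = (x - y) * x' + y * (x' - y') by ring.
have -> : X * X' - Y * Y' = (X - Y) * X' + Y * (X' - Y') by ring.
rewrite (le_trans (ler_normD _ _))// !normrM lerD// ler_pM//.
(* The bound [|x'| <= X'] is recovered from those on [y'] and [x' - y']. *)
rewrite -[x'](subrK y') -[X'](subrK Y').
by rewrite (le_trans (ler_normD _ _))// lerD.
Qed.

Definition majorant_horner g U : mpoly n R :=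
  \sum_(i < size g) mabs g`_i * U ^+ i.

Lemma dominated_horner g v u V U : dominated v u V U ->
  dominated g.[v] g.[u] (majorant_horner g V) (majorant_horner g U).
Proof.
move=> d; rewrite !horner_coef /majorant_horner.
elim: (size g) => [|N IHN].
  by move=> m; rewrite !big_ord0 !mcoeff0 subrr normr0.
rewrite !big_ord_recr/=; apply: dominatedD => //.
apply: dominatedM; first exact: dominated_mabs.
elim: N {IHN} => [|k IHk]; last by rewrite !exprS; exact: dominatedM.
rewrite !expr0 => m; rewrite !subrr normr0 mcoeff1; split=> //.
by rewrite normr_nat.
Qed.

(** The assumption says that the majorant of [g] at radius [r] sends [B] below [B]; being monotone,
    it keeps all its iterates from 0 below [B], and these dominate the iterates of [g]. *)
Lemma analytic_fixpoint g (r B : R) : 0 < r -> 0 <= B ->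
    \sum_(i < size g) meval (fun=> r) (mabs g`_i) * B ^+ i <= B ->
  exists c, forall h : 'rV[R]_n, (forall i, `|h 0 i| <= r) ->
    exists y, [/\ `|y| <= B, (map_poly (meval (h 0)) g).[y] = y &
                  pseries_sum c h y].
Proof.
move=> r0 B0 gB.
pose u k := iter k (horner g) 0; pose U k := iter k (majorant_horner g) 0.
have d0 : dominated 0 0 0 0 by move=> m; rewrite !mcoeff0 subrr normr0.
have dk k : dominated (u k) (u k.+1) (U k) (U k.+1).
  elim: k => [|k IHk]; last exact: dominated_horner.
  by move=> m; case: (dominated_horner g d0 m); rewrite /u /U /= mcoeff0 !subr0 normr0.
have mabs_ge0 p : 0 <= meval (fun=> r) (mabs p).
  rewrite raddf_sum sumr_ge0// => m _; rewrite /= mevalZ mevalX mulr_ge0//.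
  by rewrite prodr_ge0// => i _; rewrite exprn_ge0// ltW.
have UB k : 0 <= meval (fun=> r) (U k) <= B.
  elim: k => [|k /andP[IH0 IH]]; first by rewrite meval0 lexx.
  rewrite /= raddf_sum/=; apply/andP; split.
    by apply: sumr_ge0 => i _; rewrite mevalM rmorphXn/= mulr_ge0// exprn_ge0.
  apply: le_trans gB; apply: ler_sum => i _.
  by rewrite mevalM rmorphXn/= ler_wpM2l// lerXn2r.
have [||||c cP] := @pseries_of_dominated R n u U r B => //.
- by move=> k m; case: (dk k m).
- by move=> k m; case: (dk k m).
- by move=> k; case/andP: (UB k).
exists c => h hr; have [y [uy yB cy]] := cP h hr; exists y; split=> //.
have uS : meval (h 0) (u k.+1) @[k --> \oo] --> y.
  by rewrite (cvg_shiftS (fun k => meval (h 0) (u k))).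
(* [u k.+1] is the image of [u k] under [g], so by continuity it also tends to the value of [g] at
   [y]. *)
apply: cvg_unique uS => //.
rewrite (_ : (fun k => _) =
  horner (map_poly (meval (h 0)) g) \o (fun k => meval (h 0) (u k))); last first.
  by apply/funext => k; rewrite /= horner_map.
by apply: continuous_cvg => //; exact: continuous_horner.
Qed.

Lemma analytic_fixpoint_small g (eps : R) : 0 < eps ->
    (g`_0)@_mnm0 = 0 -> (g`_1)@_mnm0 = 0 ->
  exists r c, 0 < r /\ forall h : 'rV[R]_n, (forall i, `|h 0 i| <= r) ->
    exists y, [/\ `|y| <= eps, (map_poly (meval (h 0)) g).[y] = y &
                  pseries_sum c h y].
Proof.
move=> eps0 g00 g10.
pose K := \sum_(i < size g) `|(g`_i)@_mnm0|.
pose M := \sum_(i < size g) meval (fun=> 1) (mabs g`_i).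
have K0 : 0 <= K by exact: sumr_ge0.
have M10 i : 0 <= meval (fun=> 1) (mabs g`_i).
  rewrite raddf_sum sumr_ge0// => m _; rewrite /= mevalZ mevalX mulr_ge0//.
  by rewrite prodr_ge0// => j _; rewrite exprn_ge0.
have M0 : 0 <= M by exact: sumr_ge0.
(* [B] ensures [B ^+ 2 * K <= B / 2], and [r] below ensures [r * M <= B / 2]; adding 1 to [K] and
   [M] keeps the denominators nonzero and gives [B <= 1] and [r <= 1]. *)
pose B := Num.min eps (2 * (K + 1))^-1.
have B0 : 0 < B by rewrite lt_min eps0 invr_gt0; lra.
have BK : B * (2 * (K + 1)) <= 1.
  by rewrite -ler_pdivlMr ?mul1r ?ge_min ?lexx ?orbT//; lra.
have B1 : B <= 1 by nra.
pose r := B / (2 * (M + 1)).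
have r0 : 0 < r by rewrite divr_gt0//; lra.
have rM : r * (2 * (M + 1)) = B by rewrite divfK//; lra.
have r1 : r <= 1 by nra.
have [|c cP] := @analytic_fixpoint g r B r0 (ltW B0).
  apply: (@le_trans _ _ (B ^+ 2 * K + r * M)); last by nra.
  rewrite !mulr_sumr -big_split/=; apply: ler_sum => i _.
  apply: (@le_trans _ _ ((`|(g`_i)@_mnm0| + r * meval (fun=> 1) (mabs g`_i)) * B ^+ i)).
    apply: ler_wpM2r; first by rewrite exprn_ge0// ltW.
    by apply: meval_mabs_le; rewrite r1 ltW.
  have Bi : 0 <= B ^+ i <= 1 by rewrite exprn_ge0 ?exprn_ile1// ltW.
  rewrite mulrDl lerD//.
    (* Degrees 0 and 1 drop out by hypothesis; from degree 2 on, [B ^+ i <= B ^+ 2]. *)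
    case: i Bi => -[|[|i]] /= _ _; rewrite ?g00 ?g10 ?normr0 ?mul0r ?mulr0//.
    have B0' := ltW B0.
    by rewrite mulrC ler_wpM2r// -addn2 exprD ler_piMl ?exprn_ge0 ?exprn_ile1.
  by case/andP: Bi => _; apply: ler_piMr; rewrite mulr_ge0// ltW.
exists r, c; split=> // h /cP[y [yB ? ?]]; exists y; split=> //.
by rewrite (le_trans yB)// ge_min lexx.
Qed.

(** A polynomial is a constant sequence, dominated by its own majorant. *)
Lemma meval_pseries p (r : R) : 0 < r ->
  exists c, forall h : 'rV[R]_n, (forall i, `|h 0 i| <= r) ->
    pseries_sum c h (meval (h 0) p).
Proof.
move=> r0.
have [||||c cP] := @pseries_of_dominated R n (fun=> p) (fun=> mabs p) r
  (meval (fun=> r) (mabs p)) => //.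
- by move=> _ m; rewrite mcoeff_mabs.
- by move=> _ m; rewrite !subrr normr0.
exists c => h /cP[l [pl _ cl]]; suff <- : l = meval (h 0) p by [].
by apply: cvg_unique pl _ => //; exact: cvg_cst.
Qed.

Lemma near_coord (a : 'rV[R]_n) (r : R) : 0 < r ->
  \forall x \near a, forall i, `|(x - a) 0 i| <= r.
Proof.
move=> r0; apply/nbhs_ballP; exists r => //= x /= ax i.
by have [_ /(_ 0 i)] := ax; rewrite /ball/= !mxE distrC => /ltW.
Qed.

Lemma meval_real_analytic p (a : 'rV[R]_n) :
  real_analytic_at (fun x : 'rV[R]_n => meval (x 0) p) a.
Proof.
(* [q] is [p] recentred at [a], a polynomial in [x - a]. *)
pose q := comp_mpoly [tuple mpolyX R (mnm1 i) + mpolyC n (a 0 i) | i < n] p.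
have qE x : meval ((x - a) 0) q = meval (x 0) p.
  rewrite comp_mpoly_meval; apply: meval_eq => i.
  by rewrite tnth_mktuple mevalD mevalXU mevalC !mxE subrK.
have [c cP] := meval_pseries q ltr01.
exists c; near=> x; rewrite -qE; apply: cP.
by near: x; exact: near_coord.
Unshelve. all: by end_near. Qed.

End Majorant.

(** * Roots, coefficients and moments *)

Section Vieta.
Variables (R : realType) (d : nat).
Implicit Types (X sigma tau : 'rV[R]_d).

Lemma poly_ofE sigma :
  poly_of sigma = 'X^d + \sum_(i < d) sigma 0 i *: 'X^(d - i.+1).
Proof.
rewrite /poly_of big_ord_recl subn0 /sig unlift_none scale1r; congr (_ + _).
by apply: eq_bigr => i _; rewrite liftK.
Qed.

Lemma size_poly_of_tail sigma :
  (size (\sum_(i < d) sigma 0 i *: 'X^(d - i.+1))%R < size ('X^d : {poly R})%R)%N.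
Proof.
rewrite size_polyXn ltnS; apply: leq_trans (size_sum _ _ _) _.
apply/bigmax_leqP => i _; apply: leq_trans (size_scale_leq _ _) _.
by rewrite size_polyXn; have := ltn_ord i; lia.
Qed.

Lemma size_poly_of sigma : size (poly_of sigma) = d.+1.
Proof. by rewrite poly_ofE size_polyDl ?size_poly_of_tail// size_polyXn. Qed.

Lemma lead_coef_poly_of sigma : lead_coef (poly_of sigma) = 1.
Proof. by rewrite poly_ofE lead_coefDl ?size_poly_of_tail// lead_coefXn. Qed.

Lemma coef_poly_of sigma (i : 'I_d) : (poly_of sigma)`_(d - i.+1) = sigma 0 i.
Proof.
have id := ltn_ord i.
rewrite poly_ofE coefD coefXn (_ : _ == d = false) ?add0r; last by apply/negbTE/eqP; lia.
rewrite coef_sum (bigD1 i)//= coefZ coefXn eqxx mulr1 big1 ?addr0// => j ji.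
rewrite coefZ coefXn (_ : _ == _ = false) ?mulr0//; apply/negbTE/eqP => e.
by case/eqP: ji; apply/val_inj => /=; have := ltn_ord j; lia.
Qed.

Lemma poly_of_inj : injective (@poly_of R d).
Proof.
move=> sigma tau st; apply/rowP => i.
by rewrite -coef_poly_of st coef_poly_of.
Qed.

Lemma poly_of_vieta X : poly_of (vieta X) = \prod_(j < d) ('X - (X 0 j)%:P).
Proof.
(* When the product is expanded, [J] is the set of factors from which the constant term is taken;
   grouping by [#|J|] gives the coefficients. *)
pose F (J : {set 'I_d}) : R := \prod_(j in J) - X 0 j.
have -> : \prod_(j < d) ('X - (X 0 j)%:P) =
    \sum_(J : {set 'I_d}) F J *: 'X^(d - #|J|).
  under eq_bigr do rewrite addrC -polyCN.
  rewrite bigA_distr; apply: eq_bigr => J _.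
  rewrite (bigID (mem J))/= (eq_bigr (fun j => (- X 0 j)%:P)); last by move=> j ->.
  rewrite [X in _ * X](eq_bigr (fun=> 'X)); last by move=> j /negPf ->.
  rewrite -rmorph_prod/= mul_polyC; congr (_ *: _).
  rewrite (eq_bigl (fun j => j \in ~: J)); last by move=> j; rewrite finset.in_setC.
  by rewrite prodr_const cardsCs finset.setCK card_ord.
rewrite (partition_big (fun J : {set 'I_d} => inord #|J| : 'I_d.+1) xpredT)//=.
apply: eq_bigr => k _.
have cJ (J : {set 'I_d}) : (inord #|J| == k) = (#|J| == k).
  by rewrite -val_eqE/= inordK// ltnS; have := max_card (mem J); rewrite card_ord.
rewrite (eq_bigl _ _ cJ) (eq_bigr (fun J => F J *: 'X^(d - k))); last by move=> J /eqP ->.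
rewrite -scaler_suml; congr (_ *: _); rewrite /sig.
case: unliftP => [i|] ->/=.
  rewrite mxE mulr_sumr; apply: eq_bigr => J /eqP JE.
  by rewrite /F prodrN JE.
rewrite (big_pred1 finset.set0) ?/F ?finset.big_set0// => J.
by rewrite /= finset.cards_eq0.
Qed.

Definition coords X : seq R := [seq X 0 j | j : 'I_d].

Lemma prod_coords X : \prod_(x <- coords X) ('X - x%:P) = poly_of (vieta X).
Proof. by rewrite poly_of_vieta big_image. Qed.

Lemma coordsP X x : reflect (exists j, x = X 0 j) (x \in coords X).
Proof.
by apply: (iffP mapP) => [[j _ ->]|[j ->]]; exists j => //; rewrite mem_enum.
Qed.

Lemma coords_sorted X : PX R d X -> sorted <%R (coords X).
Proof.
move=> PXX; rewrite sorted_map; apply: (@sub_sorted _ (relpre val ltn)).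
  by move=> i j /PXX.
by rewrite -sorted_map val_enum_ord iota_ltn_sorted.
Qed.

Lemma coords_uniq X : PX R d X -> uniq (coords X).
Proof. by move=> /coords_sorted; apply: sorted_uniq; [exact: lt_trans|exact: ltxx]. Qed.

(** A monic polynomial of degree [d] with [d] distinct known roots is the product of the
    corresponding linear factors. *)
Lemma eq_vieta sigma X : PX R d X -> (forall j, root (poly_of sigma) (X 0 j)) ->
  sigma = vieta X.
Proof.
move=> PXX rX; apply: poly_of_inj; rewrite -prod_coords.
rewrite [LHS](@all_roots_prod_XsubC _ _ (coords X)).
- by rewrite lead_coef_poly_of scale1r.
- by rewrite size_poly_of size_image card_ord.
- by apply/allP => x /coordsP[j ->].
- by rewrite uniq_rootsE coords_uniq.
Qed.

Lemma ordered_rootsP sigma X :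
  ordered_roots sigma X <-> PX R d X /\ sigma = vieta X.
Proof.
split=> [[PXX rX]|[PXX ->]]; split=> //.
  by apply: eq_vieta => // j; apply/rX; exists j.
by move=> x; rewrite -prod_coords root_prod_XsubC; split=> /coordsP.
Qed.

Lemma coords_inj : injective coords.
Proof.
move=> X Y XY; apply/rowP => i.
have e (Z : 'rV[R]_d) : Z 0 i = nth 0 (coords Z) i.
  by rewrite (nth_map i) ?size_enum_ord// nth_ord_enum.
by rewrite e XY -e.
Qed.

(** The coefficients determine the set of roots, and a strictly increasing sequence is determined by
    its set of entries. *)
Lemma vieta_inj : {in PX R d &, injective (@vieta R d)}.
Proof.
move=> X Y; rewrite !inE => PXX PXY XY; apply: coords_inj.
apply: (irr_sorted_eq lt_trans ltxx (coords_sorted PXX) (coords_sorted PXY)) => x.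
by rewrite -!root_prod_XsubC !prod_coords XY.
Qed.

Lemma vieta_Hd X : PX R d X -> Hd R d (vieta X).
Proof. by move=> PXX; exists (coords X); rewrite prod_coords coords_uniq. Qed.

Lemma Hd_ordered_roots sigma : Hd R d sigma -> exists X, ordered_roots sigma X.
Proof.
move=> [s [sE us]].
have ss : size s = d.
  by have := size_poly_of sigma; rewrite sE size_prod_XsubC => -[].
pose t := sort <=%R s; pose X : 'rV[R]_d := \row_j t`_j.
have st : size t = d by rewrite size_sort.
exists X; split.
  move=> i j ij; rewrite !mxE lt_neqAle nth_uniq ?sort_uniq ?st//.
  rewrite neq_ltn ij/=; apply: (sorted_leq_nth le_trans le_refl) => //.
  - exact: (sort_sorted le_total).
  - by rewrite inE st.
  - by rewrite inE st.
  - exact: ltnW.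
move=> x; rewrite sE root_prod_XsubC -(mem_sort <=%R) -/t; split.
  move=> /(nthP 0)[i]; rewrite st => id <-.
  by exists (Ordinal id); rewrite mxE.
by move=> [j ->]; rewrite mxE mem_nth ?st.
Qed.

Lemma RM_ordered_roots sigma : Hd R d sigma -> ordered_roots sigma (RM sigma).
Proof. by move=> /Hd_ordered_roots h; apply: (xgetPex 0 h). Qed.

Lemma vietaK : {in PX R d, cancel (@vieta R d) (@RM R d)}.
Proof.
move=> X; rewrite inE => PXX.
have /ordered_rootsP[PXR vR] := RM_ordered_roots (vieta_Hd PXX).
by apply: vieta_inj; rewrite ?inE.
Qed.

Lemma RMK : {in Hd R d, cancel (@RM R d) (@vieta R d)}.
Proof.
move=> sigma; rewrite inE => /RM_ordered_roots /ordered_rootsP[_ sE].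
by rewrite -sE.
Qed.

(** The derivative at a node is the product of its differences with the other nodes. *)
Lemma vieta_simple_root X j : PX R d X ->
  (poly_of (vieta X))^`().[X 0 j] != 0.
Proof.
move=> PXX; rewrite -prod_coords (big_rem (X 0 j))/=; last by apply/coordsP; exists j.
rewrite derivM derivXsubC mul1r hornerD hornerM hornerXsubC subrr mul0r addr0.
by rewrite -rootE root_prod_XsubC mem_rem_uniq ?coords_uniq// inE eqxx.
Qed.

(** The sum is the combination of the values of the polynomial at the nodes [X 0 j] with weights
    [a 0 j * X 0 j ^+ (l - d)], and these values vanish. *)
Lemma moment_recurrence (a X : 'rV[R]_d) l : (d <= l)%N ->
  \sum_(i < d.+1) (\sum_(j < d) a 0 j * X 0 j ^+ (l - i)) * sig (vieta X) i = 0.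
Proof.
move=> dl; under eq_bigr do rewrite mulr_suml.
rewrite exchange_big big1//= => j _.
have /eqP : root (poly_of (vieta X)) (X 0 j).
  by rewrite -prod_coords root_prod_XsubC; apply/coordsP; exists j.
rewrite horner_sum => rj.
transitivity (a 0 j * X 0 j ^+ (l - d) * 0); last exact: mulr0.
rewrite -[in RHS]rj mulr_sumr.
apply: eq_bigr => i _; rewrite hornerZ hornerXn.
rewrite (_ : (l - i)%N = (l - d + (d - i))%N) ?exprD; first by ring.
by have := ltn_ord i; lia.
Qed.

Lemma moments_surjective X (b : nat -> R) : PX R d X ->
  exists a : 'rV[R]_d, forall k, (k < d)%N -> \sum_(j < d) a 0 j * X 0 j ^+ k = b k.
Proof.
move=> PXX; pose V := Vandermonde d X.
have uV : V \in unitmx.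
  rewrite unitmxE unitfE det_Vandermonde prodf_seq_neq0; apply/allP => i _ /=.
  rewrite prodf_seq_neq0; apply/allP => j _; apply/implyP => ij.
  by rewrite subr_eq0 gt_eqF// PXX.
exists (invmx V *m \col_(i < d) b i)^T => k kd.
have := mulKVmx uV (\col_(i < d) b i); move/matrixP/(_ (Ordinal kd) 0).
rewrite !mxE => <-; apply: eq_bigr => j _.
by rewrite !mxE mulrC.
Qed.

Lemma Lq_vieta q (mu : 'rV[R]_q.+1) X : (d <= q)%N -> PX R d X ->
  Lq mu (vieta X) <-> prony_leafX d mu X.
Proof.
move=> dq PXX; split=> [LX|[[a Y] [_ muE] /= YX]]; last first.
  move=> l dl; rewrite -[RHS](moment_recurrence a X dl) -YX.
  apply: eq_bigr => i _; rewrite -muE/= inordK//.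
  by have := ltn_ord l; lia.
have [a aE] := moments_surjective (fun k => mu 0 (inord k)) PXX.
exists (a, X) => //; split => // k.
suff mE n : (n <= q)%N -> \sum_(j < d) a 0 j * X 0 j ^+ n = mu 0 (inord n).
  by rewrite mE ?inord_val// -ltnS.
(* For [n >= d], the moments and [mu] satisfy the same recurrence at [n]. Its terms of lower index
   agree by induction and the coefficient of the top term is [sigma_0 = 1], so the top terms
   agree. *)
elim/ltn_ind: n => n IHn nq; have [|dn] := ltnP n d; first exact: aE.
have nqS : (n < q.+1)%N by [].
have := moment_recurrence a X dn; rewrite -[RHS](LX (inord n)) ?inordK//.
rewrite !big_ord_recl /= !subn0 /sig unlift_none/= !mulr1.
rewrite [X in _ + X = _ -> _](eq_bigr (fun i : 'I_d =>
  mu 0 (inord (n - lift ord0 i)) * sig (vieta X) (lift ord0 i))).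
  by move=> /addIr.
move=> i _; rewrite IHn//=; rewrite /bump; have := ltn_ord i; lia.
Qed.

End Vieta.

(** * Analyticity of the roots *)

Section Analyticity.
Variables (R : realType) (n : nat).

Lemma pseries_sumD (c c' : {ffun 'I_n -> nat} -> R) (h : 'rV[R]_n) (l l' : R) :
  pseries_sum c h l -> pseries_sum c' h l' ->
  pseries_sum (fun alpha => c alpha + c' alpha) h (l + l').
Proof.
move=> [sc cl] [sc' cl'].
have termD alpha : pseries_term (fun alpha => c alpha + c' alpha) h alpha =
  pseries_term c h alpha + pseries_term c' h alpha by exact: mulrDl.
split.
  rewrite (_ : _ \o _ = (EFin \o pseries_term c h) \+ (EFin \o pseries_term c' h))%E.
    exact: summableD.
  by apply/funext => alpha /=; rewrite termD EFinD.
under eq_fun do under eq_bigr do rewrite termD.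
under eq_fun do rewrite big_split/=.
exact: cvgD.
Qed.

Lemma meval0E (p : mpoly n R) : meval (fun=> 0) p = p@_mnm0.
Proof.
rewrite mevalE [in RHS](mpolyE p) raddf_sum; apply: eq_bigr => m _.
rewrite /= mcoeffZ mcoeffX; congr (_ * _); case: eqP => [->|/eqP m0].
  by rewrite big1// => i _; rewrite mnm0E.
rewrite prodrXr -mdegE; case: (mdeg m) (mdeg_eq0 m) => [|k _].
  by rewrite (negPf m0).
by rewrite expr0n.
Qed.

Lemma PX_open : open (PX R n).
Proof.
rewrite openE => X PXX.
pose near_lt (i j : 'I_n) : set 'rV[R]_n := [set Y | (i < j)%N -> Y 0 i < Y 0 j].
have PX_near i j : nbhs X (near_lt i j).
  have [ij|ji] := ltnP i j; last by near=> Y; rewrite /near_lt/= ltnNge ji.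
  have ltX := PXX _ _ ij.
  near=> Y => _.
  (* If each coordinate moves by at most a third of the gap, the strict order survives. *)
  have Yr : forall k, `|(Y - X) 0 k| <= (X 0 j - X 0 i) / 3.
    by near: Y; apply: near_coord; lra.
  have := Yr i; have := Yr j; rewrite !mxE !ler_norml.
  by move=> /andP[? ?] /andP[? ?]; lra.
exact: filter_forall _ (fun i => filter_forall _ (PX_near i)).
Unshelve. all: by end_near. Qed.

Lemma root_pseries (sigma : 'rV[R]_n) (x0 eps : R) : 0 < eps ->
    root (poly_of sigma) x0 -> (poly_of sigma)^`().[x0] != 0 ->
  exists r c, 0 < r /\ forall h : 'rV[R]_n, (forall i, `|h 0 i| <= r) ->
    exists x, [/\ `|x - x0| <= eps, root (poly_of (sigma + h)) x &
                  pseries_sum c h x].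
Proof.
move=> eps0 /rootP px0; set s := _.[x0] => s0.
(* [P] is the polynomial of [sigma + h], with the entries of [h] as indeterminates; fixed points [y]
   of [g] below correspond to roots [x0 + y]. *)
pose P : {poly mpoly n R} := 'X^n +
  \sum_(i < n) (mpolyC n (sigma 0 i) + mpolyX R (mnm1 i)) *: 'X^(n - i.+1).
(* Division by [s = P'(x0)] makes the part of [g] of degree 1 in [y] vanish at
   [h = 0]. *)
pose g : {poly mpoly n R} :=
  'X - (mpolyC n s^-1)%:P * (P \Po ('X + (mpolyC n x0)%:P)).
have gE (h : 'rV[R]_n) : map_poly (meval (h 0)) g =
    'X - s^-1%:P * (poly_of (sigma + h) \Po ('X + x0%:P)).
  rewrite /g rmorphB rmorphM/= map_comp_poly rmorphD/= !map_polyX !map_polyC/= !mevalC.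
  congr (_ - _ * (_ \Po _)); rewrite poly_ofE rmorphD/= map_polyXn raddf_sum/=.
  congr (_ + _); apply: eq_bigr => i _.
  by rewrite map_polyZ/= map_polyXn mevalD mevalC mevalXU mxE.
have g0 k : (g`_k)@_mnm0 = (map_poly (meval ((0 : 'rV[R]_n) 0)) g)`_k.
  by rewrite coef_map/= -meval0E; apply: meval_eq => i; rewrite mxE.
have [||r [c [r0 cP]]] := @analytic_fixpoint_small R n g eps eps0.
- rewrite g0 gE addr0 -horner_coef0 !hornerE horner_comp !hornerE.
  by rewrite px0 mulr0 oppr0.
- rewrite g0 gE addr0 -[LHS]mulr1n -coef_deriv -horner_coef0 derivB derivX derivM.
  rewrite derivC mul0r add0r.
  rewrite deriv_comp derivD derivX derivC addr0 mulr1 !hornerE horner_comp !hornerE -/s.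
  by rewrite mulVf// subrr.
have [c' c'P] := meval_pseries (mpolyC n x0) r0.
exists r, (fun alpha => c' alpha + c alpha); split=> // h hr.
have [y [ye gy cy]] := cP h hr; exists (x0 + y); split.
- by rewrite addrC addKr.
- move: gy; rewrite gE !hornerE horner_comp !hornerE => /eqP.
  rewrite -subr_eq0 addrAC subrr add0r oppr_eq0 mulf_eq0 invr_eq0 (negPf s0)/= => ?.
  by rewrite [x0 + y]addrC rootE.
- by apply: pseries_sumD => //; rewrite -[x0](mevalC (h 0)); exact: c'P.
Qed.

(** Each root is continued separately. As [PX] is open, the continued roots stay strictly ordered;
    they are thus [n] distinct roots, hence all of them, and form [RM sigma]. This yields both the
    openness of [Hd] and the analyticity of [RM]. *)
Lemma RM_pseries (sigma0 : 'rV[R]_n) : Hd R n sigma0 ->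
  exists c : 'I_n -> {ffun 'I_n -> nat} -> R, \forall sigma \near sigma0,
    Hd R n sigma /\ forall j, pseries_sum (c j) (sigma - sigma0) (RM sigma 0 j).
Proof.
move=> Hs0; have /ordered_rootsP[PX0 sE] := RM_ordered_roots Hs0.
have /nbhs_ballP[e /= e0 eP] := open_nbhs_nbhs (conj PX_open PX0).
(* Halving turns the large inequality of [root_pseries] into the strict one defining the ball. *)
have e20 : 0 < e / 2 by rewrite divr_gt0.
have rootj j : root (poly_of sigma0) (RM sigma0 0 j).
  by have [_ ->] := RM_ordered_roots Hs0; exists j.
have simplej j : (poly_of sigma0)^`().[RM sigma0 0 j] != 0.
  by rewrite [in poly_of _]sE; exact: vieta_simple_root.
have [r rP] := choice (fun j => root_pseries e20 (rootj j) (simplej j)).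
have [c cP] := choice rP.
exists c.
have : \forall sigma \near sigma0, forall j i : 'I_n, `|(sigma - sigma0) 0 i| <= r j.
  exact: filter_forall _ (fun j => near_coord sigma0 (cP j).1).
apply: filterS => sigma near_sigma.
have [x xP] := choice (fun j => (cP j).2 _ (near_sigma j)).
pose X : 'rV[R]_n := \row_j x j.
have PXX : PX R n X.
  apply: eP; split => // i j; rewrite !mxE [i]ord1 /ball/= distrC.
  have [xe _ _] := xP j; apply: le_lt_trans xe _.
  by rewrite ltr_pdivrMr// ltr_pMr// ltr1n.
have sX : sigma = vieta X.
  apply: eq_vieta => // j; rewrite mxE; have [_ + _] := xP j.
  by rewrite addrC subrK.
split; first by rewrite sX; exact: vieta_Hd.
move=> j; rewrite sX vietaK ?inE// -sX mxE.
by have [] := xP j.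
Qed.

Lemma Hd_open : open (Hd R n).
Proof.
rewrite openE => sigma0 /RM_pseries[c]; rewrite /interior.
by apply: filterS => sigma [].
Qed.

Lemma RM_real_analytic : real_analytic_on (Hd R n) (@RM R n).
Proof.
move=> j sigma0 /RM_pseries[c cP]; exists (c j).
by apply: filterS cP => sigma [].
Qed.

Lemma vieta_real_analytic (U : set 'rV[R]_n) : real_analytic_on U (@vieta R n).
Proof.
move=> i X _.
pose p : mpoly n R := (-1) ^+ i.+1 *
  \sum_(J : {set 'I_n} | #|J| == i.+1) \prod_(j in J) mpolyX R (mnm1 j).
have -> : (fun Y : 'rV[R]_n => vieta Y 0 i) = (fun Y : 'rV[R]_n => meval (Y 0) p).
  apply/funext => Y; rewrite mxE rmorphM rmorphXn rmorphN1 raddf_sum/=.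
  congr (_ * _); apply: eq_bigr => J _; rewrite rmorph_prod.
  by apply: eq_bigr => j _; rewrite /= mevalXU.
exact: meval_real_analytic.
Qed.

Lemma RM_vieta_analytic_iso :
  analytic_iso (Hd R n) (PX R n) (@RM R n) (@vieta R n).
Proof.
split.
- by split; [exact: Hd_open|exact: PX_open].
- split=> [sigma /RM_ordered_roots[]//|X]; exact: vieta_Hd.
- by split; [exact: RMK|exact: vietaK].
- exact: RM_real_analytic.
- exact: vieta_real_analytic.
Qed.

End Analyticity.

(** * Parametrization of the projected Prony leaf by hyperbolic polynomials *)

Theorem theorem4p3 (R : realType) (d q : nat) (mu : 'rV[R]_q.+1)
    (d_ge1 : (1 <= d)%N) (dq : (d <= q <= 2 * d - 1)%N) :
  [/\ analytic_iso (Hd R d) (PX R d) (@RM R d) (@vieta R d),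
      set_bij (Lhq d mu) (prony_leafX d mu) (@RM R d),
      set_bij (prony_leafX d mu) (Lhq d mu) (@vieta R d) &
      prony_leafX d mu =
        [set X | exists2 sigma, Lhq d mu sigma & ordered_roots sigma X] /\
      forall sigma, Lhq d mu sigma -> ordered_roots sigma (@RM R d sigma)].
Proof.
have [{dq}dq _] := andP dq.
(* The leaf is the preimage of [Lhq] under [vieta] within [PX]; the bijections then follow formally,
   since [RM] and [vieta] are mutually inverse. *)
have leafP X : prony_leafX d mu X <-> PX R d X /\ Lhq d mu (vieta X).
  split=> [lX|[PXX [/(Lq_vieta _ dq PXX)]]//].
  have PXX : PX R d X by case: lX => -[a Y] [+ _] /= <-.
  by split=> //; split; [exact/Lq_vieta|exact: vieta_Hd].
have LhqP sigma : Lhq d mu sigma -> PX R d (RM sigma) /\ sigma = vieta (RM sigma).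
  by move=> [_ /RM_ordered_roots/ordered_rootsP].
have RMleaf sigma : Lhq d mu sigma -> prony_leafX d mu (RM sigma).
  by move=> Ls; have [PXs sE] := LhqP _ Ls; apply/leafP; rewrite -sE.
have vietaLhq X : prony_leafX d mu X -> Lhq d mu (vieta X) by move=> /leafP[].
have vK X : prony_leafX d mu X -> RM (vieta X) = X.
  by move=> /leafP[PXX _]; rewrite vietaK ?inE.
have RK sigma : Lhq d mu sigma -> vieta (RM sigma) = sigma.
  by move=> /LhqP[_ <-].
split; first exact: RM_vieta_analytic_iso.
- split=> //.
    move=> sigma tau; rewrite !inE => Ls Lt e.
    by rewrite -(RK _ Ls) e RK.
  by move=> X lX; exists (vieta X); [exact: vietaLhq|exact: vK].
- split=> //.
    move=> X Y; rewrite !inE => lX lY e.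
    by rewrite -(vK _ lX) e vK.
  by move=> sigma Ls; exists (RM sigma); [exact: RMleaf|exact: RK].
split; last by move=> sigma [_ /RM_ordered_roots].
apply/seteqP; split=> [X lX|X [sigma Ls /ordered_rootsP[PXX sE]]].
  exists (vieta X); first exact: vietaLhq.
  by apply/ordered_rootsP; split=> //; case/leafP: lX.
by apply/leafP; rewrite -sE.
Qed.
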